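(* Let $\mathbb F$ be a field, $q\in\mathbb F$ with $q\neq 0$, and $f\in\mathbb F[h]$ with $\deg f>1$. Let $A=\mathcal H_q(f,0)$. Then $\mathrm{Aut}(A)$ is the internal direct product $$\mathrm{Aut}(A)=\{\phi\in\mathrm{Aut}(A):\phi(x)=x,\ \phi(y)=y\}\ \dot\times\ \{\phi\in\mathrm{Aut}(A):\phi(h)=h\},$$ where $\{\phi\in\mathrm{Aut}(A):\phi(h)=h\}=\{\psi_{\lambda,\mu}:\lambda,\mu\in\mathbb F^*\}\cong\mathbb F^*\times\mathbb F^*$ (with $\psi_{\lambda,\mu}(x)=\lambda x$, $\psi_{\lambda,\mu}(y)=\mu y$, $\psi_{\lambda,\mu}(h)=h$) is central in $\mathrm{Aut}(A)$. If either $\mathrm{char}\,\mathbb F=0$ or $\mathrm{char}\,\mathbb F>\deg f$, then $\{\phi\in\mathrm{Aut}(A):\phi(x)=x,\phi(y)=y\}$ is a finite cyclic group whose order divides $\deg f-1$, and hence $\mathrm{Aut}(A)$ is abelian.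
   Context: $\mathcal H_q(f,0)$ denotes the unital associative $\mathbb F$-algebra generated by $x,y,h$ with relations $hx=xf(h)$, $yh=f(h)y$, $yx=qxy$. *)

(* Defs.v *)
From HB Require Import structures.
From mathcomp Require Import all_boot all_order all_algebra.
Set Implicit Arguments. Unset Strict Implicit. Unset Printing Implicit Defensive.
Import Order.TTheory GRing.Theory Num.Theory.
Local Open Scope ring_scope.

Definition aeval (F : fieldType) (A : algType F) (f : {poly F}) (a : A) : A :=
  \sum_(i < size f) f`_i *: a ^+ i.

Definition hq_rel (F : fieldType) (q : F) (f : {poly F}) (A : algType F)
    (x y h : A) : Prop :=
  [/\ h * x = x * aeval f h, y * h = aeval f h * y & y * x = q *: (x * y)].

Definition is_alg_hom (F : fieldType) (A B : algType F) (g : A -> B) : Prop :=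
  [/\ forall a b, g (a + b) = g a + g b,
      forall (c : F) a, g (c *: a) = c *: g a,
      forall a b, g (a * b) = g a * g b & g 1 = 1].

Definition is_aut (F : fieldType) (A : algType F) (g : A -> A) : Prop :=
  is_alg_hom g /\ bijective g.

(* (A, x, y, h) is the unital associative F-algebra H_q(f,0) generated by
   x, y, h subject to the relations hq_rel: characterised by its universal
   property (x, y, h satisfy the relations, and for any F-algebra B and
   u, v, w in B satisfying them there is a unique algebra homomorphism
   A -> B sending x, y, h to u, v, w). *)
Definition is_Hq (F : fieldType) (q : F) (f : {poly F}) (A : algType F)
    (x y h : A) : Prop :=
  hq_rel q f x y h /\
  forall (B : algType F) (u v w : B), hq_rel q f u v w ->
    exists g : A -> B, [/\ is_alg_hom g, g x = u, g y = v, g h = w &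
      forall g' : A -> B, is_alg_hom g' -> g' x = u -> g' y = v -> g' h = w ->
        g' =1 g].

(* Main.v *)
(* The relations make A = H_q(f,0) graded by the bidegrees of x and y, with
   components x^i F[h] y^j.  For the weights (1,1) put on (x,y), degrees add up
   because A is a domain, so phi(h) phi(x) = phi(x) f(phi(h)) with deg f > 1
   forces the degree of phi(h) to be 0: an automorphism phi preserves F[h] and
   phi(h) = a h + b.  Comparing the degrees of the polynomials in h on both sides
   of phi(h) phi(x) = phi(x) f(phi(h)) shows that phi(x) only involves the
   components x^(j+1) F[h] y^j, and likewise for phi(y); since x is the image
   under phi of such a sum, comparing total degrees leaves phi(x) = lambda x and
   phi(y) = mu y.  Hence Aut(A) is F^* x F^* times the group of the affine maps
   h |-> a h + b commuting with f.  If deg f is invertible in F, the two leading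
   coefficients of f give a^(deg f - 1) = 1 and determine b from a, so that group
   embeds in F^* and is cyclic.

   The independence of the monomials x^i h^k y^j is obtained from a
   representation of A by nested matrices, and the grading and the spanning
   property from the universal property, applied to A[X] and to a subalgebra. *)
Require Import Defs.
From HB Require Import structures.
From mathcomp Require Import all_boot all_order all_algebra.
From mathcomp Require Import cyclic boolp ring.
Import Order.TTheory GRing.Theory Num.Theory.
Set Implicit Arguments. Unset Strict Implicit. Unset Printing Implicit Defensive.
Local Open Scope ring_scope.

(** * Polynomial evaluation and algebras over a field *)

Record central_rmorphism (F : fieldType) (R : nzRingType) := CentralRMorphism {
  crmorph :> {rmorphism F -> R};
  crmorphC : forall c r, crmorph c * r = r * crmorph c }.

(** The morphism is a phantom argument of this alias of [R]. The scaling by [F] declared on it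
    depends on that morphism and stays apart from the scaling by coefficients that matrices and
    polynomials already carry. *)
Definition calg (F : fieldType) (R : nzRingType)
  (i : central_rmorphism F R) : Type := R.

Section CentralAlgebra.
Variables (F : fieldType) (R : nzRingType) (i : central_rmorphism F R).
Local Notation B := (calg i).
HB.instance Definition _ := GRing.NzRing.on B.
Definition cscale (c : F) (r : B) : B := (i c : R) * (r : R).
Fact cscaleA a b v : cscale a (cscale b v) = cscale (a * b) v.
Proof. by rewrite /cscale rmorphM -mulrA. Qed.
Fact cscale1 : left_id 1 cscale.
Proof. by move=> v; rewrite /cscale rmorph1 mul1r. Qed.
Fact cscaleDr : right_distributive cscale +%R.
Proof. by move=> a u v; exact: (@mulrDr R). Qed.
Fact cscaleDl v : {morph cscale^~ v : a b / a + b}.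
Proof. by move=> a b; rewrite /cscale rmorphD; exact: (@mulrDl R). Qed.
HB.instance Definition _ := @GRing.Zmodule_isLmodule.Build F B
  cscale cscaleA cscale1 cscaleDr cscaleDl.
Fact cscaleAl (a : F) (u v : B) : a *: (u * v) = (a *: u) * v.
Proof. exact: (@mulrA R). Qed.
HB.instance Definition _ := @GRing.Lmodule_isLalgebra.Build F B cscaleAl.
Fact cscaleAr (a : F) (u v : B) : a *: (u * v) = u * (a *: v).
Proof.
rewrite -[LHS]/((i a : R) * ((u : R) * (v : R))).
by rewrite -[RHS]/((u : R) * ((i a : R) * (v : R))) !mulrA crmorphC.
Qed.
HB.instance Definition _ := @GRing.Lalgebra_isAlgebra.Build F B cscaleAr.
End CentralAlgebra.

Definition pev (F : fieldType) (A : algType F) (a : A) (p : {poly F}) : A :=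
  (map_poly (in_alg A) p).[a].

Section PolyEval.
Variables (F : fieldType) (A : algType F) (a : A).

(** Scalars are central, so evaluation at [a] is multiplicative even when [A] is not commutative. *)
Lemma comm_pev (p : {poly F}) : comm_poly (map_poly (in_alg A) p) a.
Proof.
apply: comm_coef_poly => k; rewrite coef_map /=.
by rewrite -scalerAl -scalerAr mul1r mulr1.
Qed.

Fact pev_linear : linear (pev a).
Proof.
move=> c p r; rewrite /pev rmorphD /= hornerD; congr (_ + _).
by rewrite -mul_polyC rmorphM /= map_polyC /= hornerCM mulr_algl.
Qed.
HB.instance Definition _ := GRing.isLinear.Build F {poly F} A _ (pev a) pev_linear.

Fact pev_monoid : monoid_morphism (pev a).
Proof.
split; first by rewrite /pev rmorph1 hornerC.
by move=> p r; rewrite /pev rmorphM hornerM_comm //; exact: comm_pev.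
Qed.
HB.instance Definition _ := GRing.isMonoidMorphism.Build {poly F} A (pev a) pev_monoid.

Lemma pevX : pev a 'X = a.
Proof. by rewrite /pev map_polyX hornerX. Qed.

Lemma pevC c : pev a c%:P = c%:A.
Proof. by rewrite /pev map_polyC hornerC. Qed.

Lemma pevE (p : {poly F}) : pev a p = aeval p a.
Proof.
rewrite -[p in LHS]coefK poly_def linear_sum; apply: eq_bigr => i _.
by rewrite linearZ rmorphXn /= pevX.
Qed.

End PolyEval.

Lemma pev_comp (F : fieldType) (A : algType F) (a : A) (p r : {poly F}) :
  pev a (p \Po r) = pev (pev a r) p.
Proof.
rewrite comp_polyE linear_sum; apply: esym; rewrite pevE; apply: eq_bigr => i _.
by rewrite linearZ rmorphXn.
Qed.

Lemma alg_hom_ops (F : fieldType) (A B : algType F) (g : A -> B) :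
  is_alg_hom g ->
  [/\ g 0 = 0, forall a, g (- a) = - g a,
      forall a n, g (a ^+ n) = g a ^+ n,
      forall (p : {poly F}) a, g (pev a p) = pev (g a) p
    & forall (I : Type) (r : seq I) (P : pred I) (E : I -> A),
        g (\sum_(i <- r | P i) E i) = \sum_(i <- r | P i) g (E i)].
Proof.
move=> [gD gZ gM g1].
have g0 : g 0 = 0 by rewrite -(scale0r (0 : A)) gZ scale0r.
have gS (I : Type) (r : seq I) (P : pred I) (E : I -> A) :
  g (\sum_(i <- r | P i) E i) = \sum_(i <- r | P i) g (E i) by exact: big_morph.
have gX a n : g (a ^+ n) = g a ^+ n.
  by elim: n => [|n IHn]; rewrite ?expr0 // !exprS gM IHn.
split=> //.
- by move=> a; rewrite -!scaleN1r gZ.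
- move=> p a; rewrite !pevE gS.
  by apply: eq_bigr => i _; rewrite gZ gX.
Qed.

Lemma alg_hom_comp (F : fieldType) (A B C : algType F) (g : B -> C) (k : A -> B) :
  is_alg_hom g -> is_alg_hom k -> is_alg_hom (g \o k).
Proof.
move=> [gD gZ gM g1] [kD kZ kM k1].
by split=> /= [a b|c a|a b|]; rewrite ?kD ?kZ ?kM ?k1 ?gD ?gZ ?gM.
Qed.

Lemma alg_hom_id (F : fieldType) (A : algType F) : is_alg_hom (@id A).
Proof. by []. Qed.

(** * Subalgebras, and generation of [A] by [x], [y], [h] *)

Section Subalgebra.
Variables (F : fieldType) (A : algType F) (S : A -> Prop).
Hypotheses (S1 : S 1) (SZ : forall c u v, S u -> S v -> S (c *: u + v))
  (SM : forall u v, S u -> S v -> S (u * v)).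

Definition subalg_pred : {pred A} := fun u => `[< S u >].

Fact subalg_pred_closed : subalg_closed subalg_pred.
Proof.
split; rewrite /in_mem /=; first exact/asboolP.
  by move=> c u v /asboolP Su /asboolP Sv; apply/asboolP/SZ.
by move=> u v /asboolP Su /asboolP Sv; apply/asboolP/SM.
Qed.
HB.instance Definition _ :=
  GRing.isSubalgClosed.Build F A subalg_pred subalg_pred_closed.

Record subalg : predArgType :=
  Subalg { subalg_val :> A; _ : subalg_val \in subalg_pred }.
HB.instance Definition _ := [isSub for subalg_val].
HB.instance Definition _ := [Choice of subalg by <:].
HB.instance Definition _ := [SubChoice_isSubAlgebra of subalg by <:].

Lemma subalg_val_hom : is_alg_hom (subalg_val : subalg -> A).
Proof. by []. Qed.

(** The generators satisfy the relations inside the subalgebra, so the universal property maps [A]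
    into it. Followed by the inclusion, this map fixes the generators and is the identity by
    uniqueness. *)
Lemma Hq_generated (q : F) (f : {poly F}) (x y h : A) :
  is_Hq q f x y h -> S x -> S y -> S h -> forall u, S u.
Proof.
move=> [[hx yh yx] univ] Sx Sy Sh u.
have mem v : S v -> v \in subalg_pred by move=> Sv; exact/asboolP.
pose x' := Subalg (mem _ Sx); pose y' := Subalg (mem _ Sy).
pose h' := Subalg (mem _ Sh).
have [_ _ valX valpev _] := alg_hom_ops subalg_val_hom.
have rel' : hq_rel q f x' y' h'.
  by split; apply: val_inj; rewrite -?pevE /= ?valpev ?pevE.
have [g [g_hom gx gy gh _]] := univ _ _ _ _ rel'.
have [k [_ _ _ _ k_uniq]] := univ A x y h (And3 hx yh yx).
have gu := k_uniq _ (alg_hom_comp subalg_val_hom g_hom).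
rewrite /= gx gy gh in gu; have {gu} gu := gu erefl erefl erefl u.
have := k_uniq _ (@alg_hom_id _ A) erefl erefl erefl u.
rewrite -gu /= => ->; case: (g u) => v vS; exact/asboolP.
Qed.
End Subalgebra.

(** * Monomials *)

(** The twist that p(h) undergoes when it moves to the right past x^k, or when y^k moves to the
    right past it ([pev_xn], [yn_pev]). *)
Definition subst (F : fieldType) (f : {poly F}) (k : nat) (p : {poly F}) :=
  iter k (fun r => r \Po f) p.

Section Subst.
Variables (F : fieldType) (f : {poly F}).
Local Notation sg := (subst f).

Fact subst_linear k : linear (sg k).
Proof. by elim: k => // k IHk c p r; rewrite /sg !iterS [iter k _ _]IHk linearP. Qed.
HB.instance Definition _ k :=
  GRing.isLinear.Build F {poly F} {poly F} _ (sg k) (@subst_linear k).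

Fact subst_monoid k : monoid_morphism (sg k).
Proof.
split; first by elim: k => // k; rewrite /sg iterS => ->; rewrite rmorph1.
elim: k => // k IHk p r; rewrite /sg !iterS [iter k _ _]IHk.
by rewrite comp_polyM.
Qed.
HB.instance Definition _ k :=
  GRing.isMonoidMorphism.Build {poly F} {poly F} (sg k) (@subst_monoid k).

Lemma substS k p : sg k.+1 p = sg k p \Po f. Proof. by []. Qed.
Lemma substSr k p : sg k.+1 p = sg k (p \Po f). Proof. exact: iterSr. Qed.

Lemma subst_comp k p r : sg k (p \Po r) = p \Po sg k r.
Proof. by elim: k => // k IHk; rewrite !substS IHk comp_polyA. Qed.

Lemma size_subst k p : (size (sg k p)).-1 = ((size p).-1 * (size f).-1 ^ k)%N.
Proof.
elim: k => [|k IHk]; first by rewrite muln1.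
by rewrite substS size_comp_poly IHk expnSr mulnA.
Qed.

Lemma subst_eq0 k p : (1 < size f)%N -> (sg k p == 0) = (p == 0).
Proof.
by move=> f1; elim: k => // k IHk; rewrite substS comp_poly_eq0.
Qed.
End Subst.

(** Only [v] and [w] are involved, so that this also applies in [row_model]'s algebra, where no [x]
    is given. *)
Lemma intertwine_pev (F : fieldType) (f : {poly F}) (A : algType F) (v w : A) p :
  v * w = aeval f w * v -> v * pev w p = pev w (p \Po f) * v.
Proof.
move=> vw; elim/poly_ind: p => [|p c IHp].
  by rewrite comp_poly0 !rmorph0 mul0r mulr0.
rewrite comp_polyD comp_polyM comp_polyX comp_polyC !rmorphD !rmorphM /= pevX.
by rewrite !pevC mulrDl mulrDr mulr_algl mulr_algr mulrA IHp -!mulrA vw -pevE.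
Qed.

Section Relations.
Variables (F : fieldType) (q : F) (f : {poly F}) (A : algType F) (x y h : A).
Local Notation sg := (subst f).
Hypothesis rel : hq_rel q f x y h.

Definition mon i p j : A := x ^+ i * pev h p * y ^+ j.

Lemma pev_x p : pev h p * x = x * pev h (p \Po f).
Proof.
have [hx _ _] := rel; elim/poly_ind: p => [|p c IHp].
  by rewrite comp_poly0 !rmorph0 mul0r mulr0.
rewrite comp_polyD comp_polyM comp_polyX comp_polyC !rmorphD !rmorphM /= pevX.
by rewrite !pevC mulrDl mulrDr mulr_algl mulr_algr -mulrA hx -pevE !mulrA IHp.
Qed.

Lemma y_pev p : y * pev h p = pev h (p \Po f) * y.
Proof. by have [_ yh _] := rel; exact: intertwine_pev. Qed.

Lemma pev_xn k p : pev h p * x ^+ k = x ^+ k * pev h (sg k p).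
Proof.
elim: k p => [|k IHk] p; first by rewrite expr0 mul1r mulr1.
by rewrite substSr exprS mulrA pev_x -mulrA IHk mulrA.
Qed.

Lemma yn_pev k p : y ^+ k * pev h p = pev h (sg k p) * y ^+ k.
Proof.
elim: k p => [|k IHk] p; first by rewrite expr0 mul1r mulr1.
by rewrite substSr exprSr -mulrA y_pev mulrA IHk mulrA.
Qed.

Lemma y_xn k : y * x ^+ k = q ^+ k *: (x ^+ k * y).
Proof.
have [_ _ yx] := rel; elim: k => [|k IHk].
  by rewrite !expr0 mul1r mulr1 scale1r.
by rewrite exprSr mulrA IHk -scalerAl -!mulrA yx -scalerAr scalerA -exprSr.
Qed.

Lemma yn_xn j k : y ^+ j * x ^+ k = q ^+ (j * k) *: (x ^+ k * y ^+ j).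
Proof.
elim: j => [|j IHj]; first by rewrite !expr0 mul1r mulr1 scale1r.
rewrite [y ^+ j.+1]exprS -mulrA IHj -scalerAr [y * (_ * _)]mulrA y_xn.
by rewrite -scalerAl scalerA -exprD addnC -mulSn !mulrA.
Qed.

(** Moving y^j past x^k costs q^(jk); then a(h) passes x^k and b(h) passes y^j. The product of two
    monomials is thus a scalar multiple of a single monomial. *)
Lemma mon_mul i a j k b l :
  mon i a j * mon k b l = q ^+ (j * k) *: mon (i + k) (sg k a * sg j b) (j + l).
Proof.
have -> : mon i a j * mon k b l =
    x ^+ i * pev h a * (y ^+ j * x ^+ k) * pev h b * y ^+ l.
  by rewrite /mon !mulrA.
rewrite yn_xn -scalerAr -!scalerAl; congr (_ *: _).
have -> : x ^+ i * pev h a * (x ^+ k * y ^+ j) * pev h b * y ^+ l =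
    x ^+ i * (pev h a * x ^+ k) * (y ^+ j * pev h b) * y ^+ l.
  by rewrite !mulrA.
by rewrite pev_xn yn_pev /mon !exprD rmorphM !mulrA.
Qed.

Lemma pev_mon i p j r : pev h r * mon i p j = mon i (sg i r * p) j.
Proof. by rewrite /mon !mulrA pev_xn rmorphM !mulrA. Qed.

Lemma mon_pev i p j r : mon i p j * pev h r = mon i (p * sg j r) j.
Proof. by rewrite /mon -!mulrA yn_pev rmorphM !mulrA. Qed.

Fact mon_linear i j : linear (mon i ^~ j).
Proof.
by move=> c p r; rewrite /mon linearP mulrDr mulrDl -scalerAr -scalerAl.
Qed.
End Relations.

(** * Independence of the monomials *)

Section MatrixAlgebra.
Variables (F : fieldType) (D : algType F) (n : nat).

Fact mxalg_central_subproof (c : F) (M : 'M[D]_n.+1) :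
  ((@scalar_mx D n.+1 \o in_alg D) c) * M = M * (@scalar_mx D n.+1 \o in_alg D) c.
Proof.
rewrite /= -diag_const_mx.
rewrite -[LHS]/(_ *m _) -[RHS]/(M *m _) mul_diag_mx mul_mx_diag.
by apply/matrixP => i j; rewrite !mxE mulr_algl mulr_algr.
Qed.

Definition mxalg_central : central_rmorphism F 'M[D]_n.+1 :=
  CentralRMorphism mxalg_central_subproof.
Local Notation MD := (calg mxalg_central).

Definition mxdiag_alg (d : nat -> D) : MD := diag_mx (\row_i d i).
(** Ones just below the diagonal. In size n+1 the bottom left entry of the n-th power is still 1,
    and the models below read off that entry. *)
Definition mxshift : MD := \matrix_(i, j) (i == j.+1 :> nat)%:R.

Lemma mxdiag_algM d e :
  mxdiag_alg d * mxdiag_alg e = mxdiag_alg (fun i => d i * e i).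
Proof.
rewrite -[LHS]/(diag_mx _ *m diag_mx _) mulmx_diag; congr diag_mx.
by apply/rowP => i; rewrite !mxE.
Qed.

Lemma mxdiag_algX d k : mxdiag_alg d ^+ k = mxdiag_alg (fun i => d i ^+ k).
Proof.
elim: k => [|k IHk]; last first.
  rewrite exprS IHk mxdiag_algM; congr diag_mx.
  by apply/rowP => i; rewrite !mxE exprS.
rewrite expr0 -[LHS]/(1%:M : 'M[D]_n.+1) -diag_const_mx; congr diag_mx.
by apply/rowP => i; rewrite !mxE expr0.
Qed.

Lemma mxdiag_algD d e :
  mxdiag_alg d + mxdiag_alg e = mxdiag_alg (fun i => d i + e i).
Proof.
rewrite -[LHS]/(diag_mx _ + diag_mx _) -raddfD; congr diag_mx.
by apply/rowP => i; rewrite !mxE.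
Qed.

Lemma mxdiag_algC (c : F) : c%:A = mxdiag_alg (fun=> c%:A).
Proof.
rewrite -[LHS]/((c%:A : D)%:M *m (1%:M : 'M[D]_n.+1)) mulmx1 -diag_const_mx.
by congr diag_mx; apply/rowP => i; rewrite !mxE.
Qed.

Lemma pev_mxdiag d p : pev (mxdiag_alg d) p = mxdiag_alg (fun i => pev (d i) p).
Proof.
elim/poly_ind: p => [|p c IHp].
  rewrite rmorph0 -[LHS]/(0 : 'M[D]_n.+1).
  by apply/matrixP => i j; rewrite !mxE rmorph0 mul0rn.
rewrite rmorphD rmorphM /= pevX pevC IHp mxdiag_algM mxdiag_algC mxdiag_algD.
by congr diag_mx; apply/rowP => i; rewrite !mxE rmorphD rmorphM /= pevX pevC.
Qed.

Lemma mxshiftX k :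
  mxshift ^+ k = \matrix_(i < n.+1, j < n.+1) (i == j + k :> nat)%N%:R :> 'M[D]_n.+1.
Proof.
elim: k => [|k IHk].
  by apply/matrixP => i j; rewrite expr0 !mxE addn0.
rewrite exprSr -[LHS]/((mxshift ^+ k : 'M[D]_n.+1) *m mxshift) {}IHk.
apply/matrixP => i j; rewrite !mxE.
have [jn|nj] := ltnP j.+1 n.+1.
  rewrite (bigD1 (Ordinal jn)) //= !mxE eqxx mulr1 addSnnS big1 ?addr0 // => l.
  by rewrite -val_eqE /= !mxE => /negPf->; rewrite mulr0.
rewrite big1 => [|l _]; last first.
  rewrite !mxE (_ : (l == j.+1 :> nat) = false) ?mulr0 //.
  by apply/negbTE; rewrite neq_ltn (leq_trans (ltn_ord l) nj).
rewrite (_ : (i == _ :> nat) = false) //.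
apply/negbTE; rewrite neq_ltn addnS -addSn (leq_trans (ltn_ord i)) //.
by rewrite (leq_trans nj) ?leq_addr.
Qed.

(** Passing the shift moves the diagonal entries by one place. The truncation makes the last column
    of the shift zero, hence the range [i < n]. *)
Lemma mxdiag_shift d e :
  (forall i, (i < n)%N -> d i.+1 = e i) ->
  mxdiag_alg d * mxshift = mxshift * mxdiag_alg e.
Proof.
move=> de; rewrite -[LHS]/(diag_mx _ *m _) -[RHS]/(_ *m diag_mx _).
rewrite mul_diag_mx mul_mx_diag; apply/matrixP => i j; rewrite !mxE.
have [ij|] := eqVneq (i : nat) j.+1; last by rewrite mulr0 mul0r.
by rewrite ij de ?mulr1 ?mul1r // -ltnS -ij.
Qed.

End MatrixAlgebra.

Lemma pev_poly (F : fieldType) (p r : {poly F}) : pev r p = p \Po r.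
Proof. by rewrite pevE comp_polyE. Qed.

(** A model over F[X] for the relation between y and h: [v] is a shift and [w] is diagonal with the
    iterates of f in decreasing order. The last diagonal entry is X itself, so the bottom left entry
    of p(w) v^b is p. *)
Lemma row_model (F : fieldType) (f : {poly F}) (b : nat) :
  exists (D : algType F) (v w : D),
    v * w = aeval f w * v /\ forall p, pev w p * v ^+ b = 0 -> p = 0.
Proof.
pose D := calg (mxalg_central ({poly F} : algType F) b).
pose w : D := mxdiag_alg b (fun j => subst f (b - j) 'X : {poly F}).
pose v : D := mxshift {poly F} b.
exists D, v, w; split.
  rewrite -pevE pev_mxdiag; apply/esym/mxdiag_shift => i ib.
  rewrite pev_poly -subst_comp comp_polyXr; case: b ib @D @w @v => // b ib _ _ _.
  by rewrite subSS subSn // substSr comp_polyX.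
move=> p; rewrite pev_mxdiag mxshiftX -[_ * _]/(diag_mx _ *m _) mul_diag_mx.
move=> /matrixP/(_ ord_max ord0); rewrite !mxE /= add0n eqxx mulr1 subnn.
by rewrite pev_poly comp_polyXr.
Qed.

(** Matrices over the previous model: x is a shift, h is diagonal with entries w, f(w), f(f(w)), and
    so on, and y is diagonal with entries q^i v, whose powers of q produce yx = qxy. The bottom left
    entry of x^a p(h) y^b is p(w) v^b. *)
Lemma column_model (F : fieldType) (q : F) (f : {poly F}) (D : algType F)
    (v w : D) (a b : nat) :
  v * w = aeval f w * v ->
  exists (E : algType F) (x y h : E), hq_rel q f x y h /\
    forall p, x ^+ a * pev h p * y ^+ b = 0 -> pev w p * v ^+ b = 0.
Proof.
move=> vw; pose E := calg (mxalg_central D a).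
pose h : E := mxdiag_alg a (fun i => pev w (subst f i 'X)).
pose y : E := mxdiag_alg a (fun i => q ^+ i *: v).
pose x : E := mxshift D a.
have v_pev p : v * pev w p = pev w (p \Po f) * v by exact: intertwine_pev.
have substX i : f \Po subst f i 'X = subst f i.+1 'X.
  by rewrite -subst_comp comp_polyXr substSr comp_polyX.
exists E, x, y, h; split; first split.
- rewrite -pevE pev_mxdiag; apply: mxdiag_shift => i _.
  by rewrite -pev_comp substX.
- rewrite -pevE pev_mxdiag !mxdiag_algM; congr diag_mx; apply/rowP => i.
  by rewrite !mxE -pev_comp substX -scalerAl -scalerAr v_pev.
- rewrite [LHS](@mxdiag_shift _ _ _ _ (fun i => q ^+ i.+1 *: v)) //.
  rewrite scalerAr; congr (_ * _); rewrite -[q *: _]mulr_algl mxdiag_algC.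
  rewrite mxdiag_algM; congr diag_mx; apply/rowP => i.
  by rewrite !mxE mulr_algl scalerA exprS.
move=> p; rewrite pev_mxdiag mxshiftX mxdiag_algX.
rewrite -mulrA mxdiag_algM -[_ * _]/(_ *m diag_mx _) mul_mx_diag.
move=> /matrixP/(_ ord_max ord0); rewrite !mxE /= add0n eqxx mul1r.
by rewrite expr0 scale1r pevX.
Qed.

(** The universal property maps [A] to the nested matrices, with sizes fitted to [i] and [j]; there
    the image of the monomial determines [p]. *)
Lemma mon_eq0 (F : fieldType) (q : F) (f : {poly F}) (A : algType F)
    (x y h : A) i p j :
  is_Hq q f x y h -> mon x y h i p j = 0 -> p = 0.
Proof.
move=> [_ univ]; have [D [v [w [vw vwP]]]] := row_model f j.
have [E [x' [y' [h' [rel' relP]]]]] := @column_model F q f D v w i j vw.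
have [g [g_hom gx gy gh _]] := univ _ _ _ _ rel'.
have [g0 _ gX gpev _] := alg_hom_ops g_hom; have [_ _ gM _] := g_hom.
move=> /(congr1 g); rewrite g0 /mon !gM !gX gpev gx gy gh => /relP.
exact: vwP.
Qed.

(** * Gradings *)

Section PolyAlgebra.
Variables (F : fieldType) (A : algType F).

Fact polyalg_central_subproof (c : F) (P : {poly A}) :
  (@polyC A \o in_alg A) c * P = P * (@polyC A \o in_alg A) c.
Proof.
by apply/polyP => i; rewrite /= coefCM coefMC mulr_algl mulr_algr.
Qed.

Definition polyalg_central : central_rmorphism F {poly A} :=
  CentralRMorphism polyalg_central_subproof.

Lemma polyC_hom : is_alg_hom (@polyC A : A -> calg polyalg_central).
Proof.
split; [exact: polyCD | | exact: polyCM | by []].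
by move=> c a; rewrite -mulr_algl polyCM.
Qed.
End PolyAlgebra.

Lemma mulCX (R : nzRingType) (a b : R) m n :
  (a%:P * 'X^m) * (b%:P * 'X^n) = (a * b)%:P * 'X^(m + n).
Proof.
rewrite mulrA -[a%:P * _ * _]mulrA -(commr_polyXn b%:P m) mulrA -polyCM.
by rewrite -mulrA -exprD.
Qed.

Lemma exprCX (R : nzRingType) (a : R) m n :
  (a%:P * 'X^m) ^+ n = (a ^+ n)%:P * 'X^(n * m).
Proof.
elim: n => [|n IHn]; first by rewrite !expr0 mulr1.
by rewrite exprS IHn mulCX -exprS mulSn.
Qed.

Section NormalForm.
Variables (F : fieldType) (q : F) (f : {poly F}) (A : algType F) (x y h : A).
Hypothesis HA : is_Hq q f x y h.
Local Notation sg := (subst f).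
Local Notation mon := (mon x y h).

Definition nform n (c : nat -> nat -> {poly F}) : A :=
  \sum_(i < n) \sum_(j < n) mon i (c i j) j.

Lemma mon0 i j : mon i 0 j = 0.
Proof. by rewrite /mon rmorph0 mulr0 mul0r. Qed.

Lemma nform_mon n i p j : (i < n)%N -> (j < n)%N ->
  nform n (fun i' j' => if (i' == i) && (j' == j) then p else 0) = mon i p j.
Proof.
move=> ni nj; rewrite /nform (bigD1 (Ordinal ni)) //= (bigD1 (Ordinal nj)) //=.
rewrite !eqxx !big1 ?addr0 // => [i' | j'].
  rewrite -val_eqE /= => /negPf ii; rewrite big1 // => j' _.
  by rewrite ii mon0.
by rewrite -val_eqE /= => /negPf->; rewrite mon0.
Qed.

Lemma nform_linear n k c d :
  nform n (fun i j => k *: c i j + d i j) = k *: nform n c + nform n d.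
Proof.
rewrite /nform scaler_sumr -big_split; apply: eq_bigr => i _ /=.
rewrite scaler_sumr -big_split; apply: eq_bigr => j _ /=.
exact: mon_linear.
Qed.

(** The monomials include the generators and, by [mon_mul], their span is closed under products. All
    bounds past some [n] are allowed so that two elements can share a bound. *)
Lemma nformP u : exists n, forall m, (n <= m)%N -> exists c, u = nform m c.
Proof.
pose S u := exists n, forall m, (n <= m)%N -> exists c, u = nform m c.
have Smon i p j : S (mon i p j).
  exists (maxn i j).+1 => m; rewrite gtn_max => /andP[im jm].
  exists (fun i' j' => if (i' == i) && (j' == j) then p else 0).
  by rewrite nform_mon.
have SZ c v w : S v -> S w -> S (c *: v + w).
  move=> [n nP] [m mP]; exists (maxn n m) => l.
  rewrite geq_max => /andP[/nP[d ->] /mP[e ->]].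
  by exists (fun i j => c *: d i j + e i j); rewrite nform_linear.
have S0 : S 0 by rewrite -(mon0 0 0); exact: Smon.
have Ssum (I : Type) (r : seq I) (E : I -> A) :
    (forall i, S (E i)) -> S (\sum_(i <- r) E i).
  move=> SE; elim: r => [|i r IHr]; first by rewrite big_nil.
  by rewrite big_cons -[E i]scale1r; exact: SZ.
have SM v w : S v -> S w -> S (v * w).
  move=> [n /(_ _ (leqnn n))[c ->]] [m /(_ _ (leqnn m))[d ->]].
  rewrite mulr_suml; apply: (Ssum) => i; rewrite mulr_suml; apply: (Ssum) => j.
  rewrite mulr_sumr; apply: (Ssum) => k; rewrite mulr_sumr; apply: (Ssum) => l.
  have [rel _] := HA.
  by rewrite (mon_mul rel) -[_ *: _]addr0; exact: SZ.
apply: (Hq_generated (S := S) _ SZ SM HA).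
- by have := Smon 0 1 0; rewrite /mon expr0 rmorph1 !mulr1.
- by have := Smon 1%N 1 0; rewrite /mon expr1 expr0 rmorph1 !mulr1.
- by have := Smon 0 1 1%N; rewrite /mon expr1 expr0 rmorph1 !mul1r.
- by have := Smon 0 'X 0; rewrite /mon !expr0 pevX mul1r mulr1.
Qed.

(** A grading encoded as a homomorphism to A[X]: the coefficient of X^d in [g u] is the component of
    [u] of degree d. *)
Definition graded w1 w2 (g : A -> calg (polyalg_central A)) :=
  is_alg_hom g /\
  forall i p j, g (mon i p j) = (mon i p j)%:P * 'X^(i * w1 + j * w2) :> {poly A}.

(** The relations are homogeneous when h has weight 0, so they hold in A[X] for x X^w1, y X^w2 and
    h. *)
Lemma gradedP w1 w2 : exists g, graded w1 w2 g.
Proof.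
have [[hx yh yx] univ] := HA.
have [_ _ CX Cpev _] := alg_hom_ops (polyC_hom A).
pose x' : calg (polyalg_central A) := x%:P * 'X^w1 : {poly A}.
pose y' : calg (polyalg_central A) := y%:P * 'X^w2 : {poly A}.
pose h' : calg (polyalg_central A) := h%:P.
have C0 (a : A) : a%:P = a%:P * 'X^0 by rewrite expr0 mulr1.
have rel' : hq_rel q f x' y' h'.
  split.
  - rewrite -pevE -Cpev pevE -[LHS]/(h%:P * (x%:P * 'X^w1)).
    rewrite -[RHS]/(x%:P * 'X^w1 * (_)%:P) [h%:P]C0 [(aeval _ _)%:P]C0.
    by rewrite !mulCX hx addn0.
  - rewrite -pevE -Cpev pevE -[LHS]/(y%:P * 'X^w2 * h%:P).
    rewrite -[RHS]/((_)%:P * (y%:P * 'X^w2)) [h%:P]C0 [(aeval _ _)%:P]C0.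
    by rewrite !mulCX yh addn0.
  rewrite -[LHS]/(y%:P * 'X^w2 * (x%:P * 'X^w1)).
  rewrite -[RHS]/((q%:A)%:P * (x%:P * 'X^w1 * (y%:P * 'X^w2))).
  by rewrite !mulCX mulrA -polyCM mulr_algl addnC yx.
have [g [g_hom gx gy gh _]] := univ _ _ _ _ rel'.
have [_ _ gX gpev _] := alg_hom_ops g_hom; have [_ _ gM _] := g_hom.
exists g; split=> // i p j; rewrite !gM !gX gpev gx gy gh -Cpev.
rewrite -[LHS]/((x%:P * 'X^w1) ^+ i * (pev h p)%:P * (y%:P * 'X^w2) ^+ j).
by rewrite !exprCX [(pev h p)%:P]C0 !mulCX addn0.
Qed.
End NormalForm.

(** * Uniqueness of normal forms, and absence of zero divisors *)

Section Domain.
Variables (F : fieldType) (q : F) (f : {poly F}) (A : algType F) (x y h : A).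
Hypotheses (q0 : q != 0) (f2 : (2 < size f)%N) (HA : is_Hq q f x y h).
Local Notation sg := (subst f).
Local Notation mon := (mon x y h).
Let f1 : (1 < size f)%N. Proof. exact: ltnW. Qed.
Local Notation nform := (nform x y h).
Local Notation graded := (graded x y h).

Section Graded.
Variables (w1 w2 : nat) (g : A -> calg (polyalg_central A)).
Hypothesis gP : graded w1 w2 g.

Lemma graded_nform n c : g (nform n c) =
  \sum_(i < n) \sum_(j < n) (mon i (c i j) j)%:P * 'X^(i * w1 + j * w2) :> {poly A}.
Proof.
have [g_hom gmon] := gP; have [_ _ _ _ gS] := alg_hom_ops g_hom.
rewrite gS; apply: eq_bigr => i _; rewrite gS; apply: eq_bigr => j _.
exact: gmon.
Qed.

Lemma coef_graded n c d : (g (nform n c) : {poly A})`_d =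
  \sum_(i < n) \sum_(j < n)
    if d == (i * w1 + j * w2)%N then mon i (c i j) j else 0.
Proof.
rewrite graded_nform coef_sum; apply: eq_bigr => i _.
rewrite coef_sum; apply: eq_bigr => j _.
by rewrite coefCM coefXn; case: eqP => _; rewrite ?mulr1 ?mulr0.
Qed.

(** Setting X = 1 adds up the homogeneous components; hence [g] is injective. *)
Lemma graded1 u : (g u : {poly A}).[1] = u.
Proof.
have [n /(_ _ (leqnn n))[c ->]] := nformP HA u.
rewrite graded_nform horner_sum; apply: eq_bigr => i _.
rewrite horner_sum; apply: eq_bigr => j _.
by rewrite hornerCM hornerXn expr1n mulr1.
Qed.

Lemma graded_eq0 u : ((g u : {poly A}) == 0) = (u == 0).
Proof.
apply/eqP/eqP => [gu0 | ->]; first by rewrite -(graded1 u) gu0 horner0.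
by have [g_hom _] := gP; have [-> _ _ _ _] := alg_hom_ops g_hom.
Qed.

Lemma graded0 : g 0 = 0.
Proof. by apply/eqP; rewrite graded_eq0. Qed.
End Graded.

(* With the weights 1 and n, distinct pairs of exponents below n have distinct
   degrees. *)
Lemma coef_graded1n n g c d : graded 1 n g -> (g (nform n c) : {poly A})`_d =
  if (d %/ n < n)%N then mon (d %% n) (c (d %% n)%N (d %/ n)%N) (d %/ n) else 0.
Proof.
move=> gP; rewrite (coef_graded gP).
have [->|n_gt0] := posnP n; first by rewrite big_ord0.
have dE i j : (i < n)%N ->
    (d == (i * 1 + j * n)%N) = (i == (d %% n)%N) && (j == (d %/ n)%N).
  move=> ni; rewrite muln1; apply/eqP/andP => [-> | [/eqP-> /eqP->]].
    by rewrite addnC modnMDl divnMDl // divn_small // modn_small // addn0.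
  by rewrite addnC -divn_eq.
rewrite (bigD1 (Ordinal (ltn_pmod d n_gt0))) //= [X in _ + X]big1 ?addr0; last first.
  move=> i; rewrite -val_eqE /= => /negPf ni; rewrite big1 // => j _.
  by rewrite dE // ni.
case: ltnP => dn.
  rewrite (bigD1 (Ordinal dn)) //= big1 ?addr0 => [|j].
    by rewrite dE ?ltn_pmod // !eqxx.
  by rewrite -val_eqE /= dE ?ltn_pmod // eqxx => /negPf->.
rewrite big1 // => j _; rewrite dE ?ltn_pmod // eqxx /= ifN //.
by rewrite neq_ltn (leq_trans (ltn_ord j)).
Qed.

(** For the weights 1 and n, the component of degree jn + i is a single monomial, to which [mon_eq0]
    applies. *)
Lemma nform_eq0 n c i j : nform n c = 0 -> (i < n)%N -> (j < n)%N -> c i j = 0.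
Proof.
move=> nf0 ni nj; have n_gt0 : (0 < n)%N by apply: leq_ltn_trans ni.
have [g gP] := gradedP HA 1 n.
have := coef_graded1n c (j * n + i) gP; rewrite nf0.
rewrite (graded0 gP) coef0.
rewrite modnMDl divnMDl // divn_small // modn_small // addn0 nj.
by move=> /esym/(mon_eq0 HA).
Qed.

Lemma nform_inj n c d i j : nform n c = nform n d ->
  (i < n)%N -> (j < n)%N -> c i j = d i j.
Proof.
move=> cd ni nj; apply: subr0_eq; rewrite addrC -scaleN1r.
apply: (@nform_eq0 n (fun i j => - 1 *: d i j + c i j)) => //.
by rewrite nform_linear cd scaleN1r addNr.
Qed.

(** For the weights 1 and k, with k bounding all exponents, the leading coefficients are single
    monomials. Their product is nonzero because q is nonzero and composition with the nonconstant f
    is injective. *)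
Lemma Hq_mulf_eq0 (u v : A) : u * v = 0 -> u = 0 \/ v = 0.
Proof.
have [-> | u0] := eqVneq u 0; first by left.
have [-> | v0] := eqVneq v 0; first by right.
have [n nP] := nformP HA u; have [m mP] := nformP HA v.
have [c uE] := nP _ (leq_maxl n m); have [d vE] := mP _ (leq_maxr n m).
set k := maxn n m in uE vE; have [g gP] := gradedP HA 1 k.
have lead_mon c' : exists i p j, lead_coef (g (nform k c') : {poly A}) = mon i p j.
  rewrite lead_coefE (coef_graded1n _ _ gP); case: ifP => _; first by do 3!eexists.
  by exists 0, 0, 0; rewrite mon0.
have lead_n0 w : w != 0 -> lead_coef (g w : {poly A}) != 0.
  by rewrite lead_coef_eq0 (graded_eq0 gP).
move: (lead_n0 _ u0) (lead_n0 _ v0); rewrite uE vE.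
have [i [p [j pE]]] := lead_mon c; have [i' [r [j' rE]]] := lead_mon d.
have [[_ _ gM _] _] := gP; have [rel _] := HA.
rewrite pE rE -uE -vE => p0 r0 uv0.
(* Were this product nonzero, it would be the leading coefficient of g(uv) = 0. *)
have: lead_coef (g u : {poly A}) * lead_coef (g v : {poly A}) == 0.
  apply/negPn/negP => nz; have := lead_coef_proper_mul nz.
  rewrite -[_ * _ : {poly A}]/(g u * g v) -gM uv0 (graded0 gP) lead_coef0.
  by move=> E; rewrite -E eqxx in nz.
rewrite uE vE pE rE (mon_mul rel) scaler_eq0 expf_eq0 (negPf q0) andbF /=.
move=> /eqP/(mon_eq0 HA)/eqP; rewrite mulf_eq0 !subst_eq0 //.
case/orP=> /eqP z0; first by rewrite z0 mon0 eqxx in p0.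
by rewrite z0 mon0 eqxx in r0.
Qed.

End Domain.

(** * Total degree, for the weights 1 and 1 *)

Section Degree.
Variables (F : fieldType) (q : F) (f : {poly F}) (A : algType F) (x y h : A).
Hypotheses (q0 : q != 0) (f2 : (2 < size f)%N) (HA : is_Hq q f x y h).
Local Notation sg := (subst f).
Local Notation mon := (mon x y h).
Local Notation nform := (nform x y h).
Variable g : A -> calg (polyalg_central A).
Hypothesis gP : graded x y h 1 1 g.

(** Zero gets degree 0 as well, hence the nonvanishing assumptions in the lemmas that follow. *)
Definition deg (u : A) : nat := (size (g u : {poly A})).-1.

Lemma degM u v : u != 0 -> v != 0 -> deg (u * v) = (deg u + deg v)%N.
Proof.
move=> u0 v0; have [[_ _ gM _] _] := gP.
have gu0 : (g u : {poly A}) != 0 by rewrite (graded_eq0 HA gP).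
have gv0 : (g v : {poly A}) != 0 by rewrite (graded_eq0 HA gP).
have lead0 : lead_coef (g u : {poly A}) * lead_coef (g v : {poly A}) != 0.
  apply/eqP => /(Hq_mulf_eq0 q0 f2 HA)[] /eqP; rewrite lead_coef_eq0; exact/negP.
rewrite /deg gM (size_proper_mul lead0).
move: gu0 gv0; rewrite -!size_poly_gt0 -!subn1.
case: (size _) => // m _; case: (size _) => // k _.
by rewrite addSn addnS !subn1.
Qed.

Lemma degX u n : u != 0 -> u ^+ n != 0 /\ deg (u ^+ n) = (n * deg u)%N.
Proof.
move=> u0; elim: n => [|n [un0 IHn]].
  have [[_ _ _ g1] _] := gP.
  by rewrite expr0 oner_eq0 /deg g1 size_poly1.
rewrite exprS degM // IHn; split=> //.
by apply/eqP => /(Hq_mulf_eq0 q0 f2 HA)[]; apply/eqP.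
Qed.

Lemma degZ c u : c != 0 -> deg (c *: u) = deg u.
Proof.
move=> c0; have [[_ gZ _ g1] _] := gP.
have [-> | u0] := eqVneq u 0; first by rewrite scaler0.
rewrite -mulr_algl degM ?scaler_eq0 ?oner_eq0 ?orbF //.
rewrite {1}/deg gZ g1 -[_ *: 1]/((c%:A)%:P * 1 : {poly A}) mulr1.
by rewrite size_polyC; case: (_ == 0).
Qed.

Lemma deg_sum n (t : nat -> A) : t n != 0 ->
  (forall i, (i < n)%N -> t i != 0 -> (deg (t i) < deg (t n))%N) ->
  deg (\sum_(i < n.+1) t i) = deg (t n).
Proof.
move=> tn0 tP; have [g_hom _] := gP; have [_ _ _ _ gS] := alg_hom_ops g_hom.
rewrite /deg big_ord_recr /=; have [-> _ _ _] := g_hom.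
rewrite addrC size_polyDl // gS.
have gn0 : (0 < size (g (t n) : {poly A}))%N.
  by rewrite size_poly_gt0 (graded_eq0 HA gP).
rewrite -(prednK gn0) ltnS; apply: leq_trans (size_sum _ _ _) _.
apply/bigmax_leqP => i _; have [-> | ti0] := eqVneq (t i) 0.
  by rewrite (graded0 HA gP) size_poly0.
have := tP i (ltn_ord i) ti0; rewrite /deg.
by apply: leq_trans; exact: leqSpred.
Qed.

(** As H has positive degree, its powers have distinct degrees and the top term of f dominates. *)
Lemma deg_aeval H : (0 < deg H)%N -> deg (aeval f H) = ((size f).-1 * deg H)%N.
Proof.
move=> dH; have H0 : H != 0.
  by apply: contraTneq dH => ->; rewrite /deg (graded0 HA gP) size_poly0.
have Hn n := degX n H0.
rewrite /aeval; case sf: (size f) => [|n] /=; first by move: f2; rewrite sf.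
have fn0 : f`_n != 0.
  by rewrite -[n]/n.+1.-1 -sf -lead_coefE lead_coef_eq0 -size_poly_gt0 sf.
rewrite (@deg_sum n (fun i => f`_i *: H ^+ i)).
- by rewrite degZ // (Hn n).2.
- by rewrite scaler_eq0 negb_or fn0 (Hn n).1.
move=> i ni; rewrite scaler_eq0 negb_or => /andP[fi0 _].
by rewrite !degZ // !(Hn _).2 ltn_mul2r dH.
Qed.

(** Both weights are positive, so only the monomials x^0 p(h) y^0 have degree 0. *)
Lemma deg_eq0 u : deg u = 0%N -> exists p, u = pev h p.
Proof.
have [n nP] := nformP HA u; have {nP} [c uE] := nP n.+1 (leqnSn n).
move=> du; exists (c 0 0)%N; rewrite -{1}(graded1 HA gP u).
have /size1_polyC-> : (size (g u : {poly A}) <= 1)%N.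
  by apply: leq_trans (leqSpred _) _; rewrite -/(deg u) du.
rewrite hornerC uE (coef_graded gP) big_ord_recl big_ord_recl /= !big1 ?addr0 //.
by rewrite /mon !expr0 mul1r mulr1.
Qed.
End Degree.

(** * The shape of an automorphism *)

Section Automorphism.
Variables (F : fieldType) (q : F) (f : {poly F}) (A : algType F) (x y h : A).
Hypotheses (q0 : q != 0) (f2 : (2 < size f)%N) (HA : is_Hq q f x y h).
Local Notation sg := (subst f).
Local Notation mon := (mon x y h).
Local Notation nform := (nform x y h).

Let fdeg1 : (1 < (size f).-1)%N. Proof. by rewrite -subn1 ltn_subRL. Qed.

Lemma pev_inj : injective (pev h).
Proof.
move=> p r pr; apply: subr0_eq; apply: (mon_eq0 (i := 0) (j := 0) HA).
by rewrite /mon !expr0 mul1r mulr1 rmorphB /= pr subrr.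
Qed.

Lemma pev_eq0 p : (pev h p == 0) = (p == 0).
Proof. by rewrite -(rmorph0 (pev h)) (inj_eq pev_inj). Qed.

Lemma x_pev_inj p r : x * pev h p = x * pev h r -> p = r.
Proof.
move=> pr; apply: subr0_eq; apply: (mon_eq0 (i := 1) (j := 0) HA).
by rewrite /mon expr0 mulr1 expr1 rmorphB /= mulrBr pr subrr.
Qed.

Lemma pev_y_inj p r : pev h p * y = pev h r * y -> p = r.
Proof.
move=> pr; apply: subr0_eq; apply: (mon_eq0 (i := 0) (j := 1) HA).
by rewrite /mon expr0 mul1r expr1 rmorphB /= mulrBl pr subrr.
Qed.

Lemma Hq_x_neq0 : x != 0.
Proof.
apply/eqP => x0; have /eqP : (1 : {poly F}) = 0.
  by apply: x_pev_inj; rewrite x0 !mul0r.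
by rewrite oner_eq0.
Qed.

Lemma Hq_y_neq0 : y != 0.
Proof.
apply/eqP => y0; have /eqP : (1 : {poly F}) = 0.
  by apply: pev_y_inj; rewrite y0 !mulr0.
by rewrite oner_eq0.
Qed.

(** The images of the generators under [g] satisfy the relations, so the uniqueness clause applies
    to them. *)
Lemma Hq_hom_ext (B : algType F) (g k : A -> B) : is_alg_hom g -> is_alg_hom k ->
  g x = k x -> g y = k y -> g h = k h -> g =1 k.
Proof.
move=> g_hom k_hom gx gy gh; have [[hx yh yx] univ] := HA.
have rel : hq_rel q f (g x) (g y) (g h).
  have [_ gZ gM _] := g_hom; have [_ _ _ gpev _] := alg_hom_ops g_hom.
  by split; rewrite -?pevE -?gpev -?gM ?pevE ?hx ?yh ?yx ?gZ.
have [l [_ _ _ _ l_uniq]] := univ _ _ _ _ rel.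
by move=> u; rewrite (l_uniq g) // (l_uniq k).
Qed.

(** For a nonzero coefficient of x^i y^j, uniqueness of normal forms and cancellation in F[h] equate
    a polynomial of degree (deg f)^i with one of degree (deg f)^(j+1). As deg f > 1, i = j+1. *)
Lemma intertwiner_exponents (H : {poly F}) X : size H = 2%N ->
  pev h H * X = X * pev h (f \Po H) ->
  exists n (c : nat -> {poly F}), X = \sum_(j < n) mon j.+1 (c j) j.
Proof.
move=> sH HX; have [n /(_ _ (leqnn n))[c XE]] := nformP HA X.
have [rel _] := HA.
have cE i j : (i < n)%N -> (j < n)%N -> c i j != 0 -> i = j.+1.
  move=> ni nj cij; have: sg i H * c i j = c i j * sg j (f \Po H).
    apply: (nform_inj (c := fun i j => sg i H * c i j)
      (d := fun i j => c i j * sg j (f \Po H)) HA _ ni nj).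
    move: HX; rewrite XE mulr_sumr mulr_suml => HX; apply: etrans (etrans _ HX) _.
      apply: eq_bigr => k _; rewrite mulr_sumr; apply: eq_bigr => l _.
      by rewrite (pev_mon rel).
    apply: eq_bigr => k _; rewrite mulr_suml; apply: eq_bigr => l _.
    by rewrite (mon_pev rel).
  rewrite mulrC => /(mulfI cij)/(congr1 (fun p : {poly F} => (size p).-1)).
  rewrite !size_subst size_comp_poly sH muln1 mul1n -expnS => /eqP.
  by rewrite eqn_exp2l // => /eqP.
(* For the last [j] the exponent [j.+1] falls outside the normal form, and the coefficient is padded
   by 0. *)
exists n, (fun j => if (j.+1 < n)%N then c j.+1 j else 0).
rewrite XE /nform exchange_big; apply: eq_bigr => j _ /=.
have [jn | nj] := ltnP j.+1 n.
  rewrite (bigD1 (Ordinal jn)) //= big1 ?addr0 // => i; rewrite -val_eqE /= => ij.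
  have [-> | cij] := eqVneq (c i j) 0; first by rewrite mon0.
  by rewrite (cE i j) ?eqxx in ij.
rewrite mon0 big1 // => i _.
have [-> | cij] := eqVneq (c i j) 0; first by rewrite mon0.
by have := ltn_ord i; rewrite (cE i j) // ltnNge nj.
Qed.

(** Mirror image: the degrees are now (deg f)^j and (deg f)^(i+1). *)
Lemma intertwiner_exponents_r (H : {poly F}) Y : size H = 2%N ->
  Y * pev h H = pev h (f \Po H) * Y ->
  exists n (c : nat -> {poly F}), Y = \sum_(j < n) mon j (c j) j.+1.
Proof.
move=> sH HY; have [n /(_ _ (leqnn n))[c YE]] := nformP HA Y.
have [rel _] := HA.
have cE i j : (i < n)%N -> (j < n)%N -> c i j != 0 -> j = i.+1.
  move=> ni nj cij; have: c i j * sg j H = sg i (f \Po H) * c i j.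
    apply: (nform_inj (c := fun i j => c i j * sg j H)
      (d := fun i j => sg i (f \Po H) * c i j) HA _ ni nj).
    move: HY; rewrite YE mulr_sumr mulr_suml => HY; apply: etrans (etrans _ HY) _.
      apply: eq_bigr => k _; rewrite mulr_suml; apply: eq_bigr => l _.
      by rewrite (mon_pev rel).
    apply: eq_bigr => k _; rewrite mulr_sumr; apply: eq_bigr => l _.
    by rewrite (pev_mon rel).
  rewrite [RHS]mulrC => /(mulfI cij)/(congr1 (fun p : {poly F} => (size p).-1)).
  rewrite !size_subst size_comp_poly sH muln1 mul1n -expnS => /eqP.
  by rewrite eqn_exp2l // => /eqP.
exists n, (fun j => if (j.+1 < n)%N then c j j.+1 else 0).
rewrite YE /nform; apply: eq_bigr => i _ /=.
have [jn | nj] := ltnP i.+1 n.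
  rewrite (bigD1 (Ordinal jn)) //= big1 ?addr0 // => j; rewrite -val_eqE /= => ij.
  have [-> | cij] := eqVneq (c i j) 0; first by rewrite mon0.
  by rewrite (cE i j) ?eqxx in ij.
rewrite mon0 big1 // => j _.
have [-> | cij] := eqVneq (c i j) 0; first by rewrite mon0.
by have := ltn_ord j; rewrite (cE i j) // ltnNge nj.
Qed.
End Automorphism.

(** * Images of [h], [x] and [y] under an automorphism *)

Section AutomorphismShape.
Variables (F : fieldType) (q : F) (f : {poly F}) (A : algType F) (x y h : A).
Hypotheses (q0 : q != 0) (f2 : (2 < size f)%N) (HA : is_Hq q f x y h).
Local Notation mon := (mon x y h).

Let fdeg1 : (1 < (size f).-1)%N. Proof. by rewrite -subn1 ltn_subRL. Qed.
Let rel : hq_rel q f x y h. Proof. by case: HA. Qed.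

(** The nonzero terms have degrees strictly increasing with [j], so the last of them gives the
    degree of the sum. For j > 0 that degree is at least 2, so total degree 1 leaves only j = 0. *)
Lemma deg_sandwich g (X Y : A) (w : nat -> A) (a b n : nat) :
  graded x y h 1 1 g -> (0 < deg g X)%N -> (0 < deg g Y)%N ->
  (forall j, deg g (w j) = 0)%N ->
  deg g (\sum_(j < n) X ^+ (j + a) * w j * Y ^+ (j + b)) = 1%N ->
  \sum_(j < n) X ^+ (j + a) * w j * Y ^+ (j + b) = X ^+ a * w 0%N * Y ^+ b.
Proof.
move=> gP dX dY dw; have deg0 : deg g 0 = 0%N.
  by rewrite /deg (graded0 HA gP) size_poly0.
have nz u : (0 < deg g u)%N -> u != 0.
  by move=> du; apply: contraTneq du => ->; rewrite deg0.
have mul_n0 u v : u != 0 -> v != 0 -> u * v != 0 :> A.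
  by move=> /eqP u0 /eqP v0; apply/eqP => /(Hq_mulf_eq0 q0 f2 HA)[].
have degXn Z k : (0 < deg g Z)%N -> Z ^+ k != 0 /\ deg g (Z ^+ k) = (k * deg g Z)%N.
  by move=> dZ; exact: (degX q0 f2 HA gP k (nz Z dZ)).
have term_n0 j : w j != 0 -> X ^+ (j + a) * w j * Y ^+ (j + b) != 0.
  move=> wj; apply: (mul_n0 _ _ (mul_n0 _ _ _ wj) _); last exact: (degXn _ _ dY).1.
  exact: (degXn _ _ dX).1.
have deg_term j : w j != 0 -> deg g (X ^+ (j + a) * w j * Y ^+ (j + b)) =
    ((j + a) * deg g X + (j + b) * deg g Y)%N.
  move=> wj; have [Xj dXj] := degXn _ (j + a)%N dX.
  have [Yj dYj] := degXn _ (j + b)%N dY.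
  rewrite (degM q0 f2 HA gP (mul_n0 _ _ Xj wj) Yj) (degM q0 f2 HA gP Xj wj).
  by rewrite dXj dYj dw addn0.
elim: n => [|n IHn]; first by rewrite big_ord0 deg0.
have [wn0 | wn] := eqVneq (w n) 0.
  by rewrite big_ord_recr /= wn0 mulr0 mul0r addr0.
rewrite (@deg_sum _ _ _ _ _ _ _ HA _ gP n (fun j => X ^+ (j + a) * w j * Y ^+ (j + b))).
- rewrite deg_term //; case: n {IHn wn} => [_|n]; first by rewrite big_ord1 !add0n.
  move: dX dY; case: (deg g X) => // dX' _; case: (deg g Y) => // dY' _.
  by rewrite !addSn !mulSn !addSn addnS.
- exact: term_n0.
move=> i ni; have [-> | wi _] := eqVneq (w i) 0; first by rewrite mulr0 mul0r eqxx.
rewrite !deg_term // -addSn; apply: leq_add.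
  by rewrite ltn_mul2r dX ltn_add2r.
by rewrite leq_mul2r leq_add2r ltnW ?orbT.
Qed.

Section Endomorphism.
Variables (phi : A -> A).
Hypotheses (phi_hom : is_alg_hom phi) (phi_inj : injective phi).

Let phi0 : phi 0 = 0. Proof. by case: (alg_hom_ops phi_hom). Qed.
Let phi_n0 u : u != 0 -> phi u != 0.
Proof. by rewrite -{2}phi0 (inj_eq phi_inj). Qed.

(** Injectivity makes [phi x] nonzero, so its degree cancels in the image of hx = xf(h). A positive
    degree d of [phi h] would then satisfy d = (deg f) d. *)
Lemma endo_h : exists H, phi h = pev h H.
Proof.
have [g gP] := gradedP HA 1 1; apply: (deg_eq0 HA gP).
have [_ _ phiM _] := phi_hom; have [_ _ _ phipev _] := alg_hom_ops phi_hom.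
apply/eqP; rewrite -leqn0 leqNgt; apply/negP => dH.
have [hx _ _] := rel.
have := congr1 phi hx; rewrite !phiM -pevE phipev pevE => HX.
have X0 : phi x != 0 by apply/phi_n0/(Hq_x_neq0 HA).
have dfH := deg_aeval q0 f2 HA gP dH.
have nz u : (0 < deg g u)%N -> u != 0.
  by move=> du; apply: contraTneq du => ->; rewrite /deg (graded0 HA gP) size_poly0.
have fH0 : aeval f (phi h) != 0.
  by apply: nz; rewrite dfH muln_gt0 dH (ltnW fdeg1).
have := congr1 (deg g) HX.
rewrite (degM q0 f2 HA gP (nz _ dH) X0) (degM q0 f2 HA gP X0 fH0) dfH.
rewrite addnC => /addnI/eqP; rewrite -{1}[deg g _]mul1n eqn_pmul2r //.
by rewrite eqn_leq [(_ <= 1)%N]leqNgt fdeg1 andbF.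
Qed.
End Endomorphism.

Lemma deg_pev g p : graded x y h 1 1 g -> deg g (pev h p) = 0%N.
Proof.
move=> [_ gmon]; have := gmon 0%N p 0%N.
rewrite /mon !expr0 mul1r mulr1 mulr1 /deg => ->.
by rewrite size_polyC; case: (_ == 0).
Qed.

Section Inverses.
Variables (phi psi : A -> A).
Hypotheses (phi_hom : is_alg_hom phi) (psi_hom : is_alg_hom psi).
Hypotheses (phiK : cancel phi psi) (psiK : cancel psi phi).

(** With psi(h) = H'(h), the identity phi(psi(h)) = h reads H'(H) = X, so both degrees are 1. *)
Lemma auto_h_size H : phi h = pev h H -> size H = 2%N.
Proof.
move=> phih; have [H' psih] := endo_h psi_hom (can_inj psiK).
have [_ _ _ phipev _] := alg_hom_ops phi_hom.
have := psiK h; rewrite psih phipev phih -pev_comp -{2}[h]pevX => /(pev_inj HA) HH.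
have := size_comp_poly H' H; rewrite HH size_polyX /= => /esym/eqP.
by rewrite muln_eq1 => /andP[_ /eqP]; case: (size H) => //= n ->.
Qed.

(** Otherwise [phi x] is a nonzero polynomial in h. It commutes with [phi h] and cancels, which
    leaves H = f(H), against deg f > 1. *)
Lemma auto_deg_x H g : graded x y h 1 1 g -> phi h = pev h H ->
  (0 < deg g (phi x))%N.
Proof.
move=> gP phih; rewrite lt0n; apply/eqP => /(deg_eq0 HA gP)[p phix].
have [_ _ phiM _] := phi_hom; have [_ _ _ phipev _] := alg_hom_ops phi_hom.
have [hx _ _] := rel; have sH := auto_h_size phih.
have := congr1 phi hx; rewrite !phiM -pevE phipev phih -pev_comp phix.
rewrite -!rmorphM => /(pev_inj HA); rewrite mulrC => /mulfI H_f.
have p0 : p != 0.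
  rewrite -(pev_eq0 HA) -phix; apply: contraNneq (Hq_x_neq0 HA) => X0.
  by rewrite -(phiK x) X0; have [-> ] := alg_hom_ops psi_hom.
have := size_comp_poly f H; rewrite -(H_f p0) sH muln1 => E.
by move: fdeg1; rewrite -E.
Qed.

Lemma auto_deg_y H g : graded x y h 1 1 g -> phi h = pev h H ->
  (0 < deg g (phi y))%N.
Proof.
move=> gP phih; rewrite lt0n; apply/eqP => /(deg_eq0 HA gP)[p phiy].
have [_ _ phiM _] := phi_hom; have [_ _ _ phipev _] := alg_hom_ops phi_hom.
have [_ yh _] := rel; have sH := auto_h_size phih.
have := congr1 phi yh; rewrite !phiM -pevE phipev phih -pev_comp phiy.
rewrite -!rmorphM => /(pev_inj HA); rewrite [RHS]mulrC => /mulfI H_f.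
have p0 : p != 0.
  rewrite -(pev_eq0 HA) -phiy; apply: contraNneq (Hq_y_neq0 HA) => X0.
  by rewrite -(phiK y) X0; have [-> ] := alg_hom_ops psi_hom.
have := size_comp_poly f H; rewrite -(H_f p0) sH muln1 => E.
by move: fdeg1; rewrite -E.
Qed.
End Inverses.

Section Inverses2.
Variables (phi psi : A -> A).
Hypotheses (phi_hom : is_alg_hom phi) (psi_hom : is_alg_hom psi).
Hypotheses (phiK : cancel phi psi) (psiK : cancel psi phi).

(* Only monomials x^(j+1) p(h) y^j occur in psi x, and their images under phi
   have distinct degrees, while phi (psi x) = x has degree 1. *)
Lemma auto_x_pev : exists p, psi x = x * pev h p.
Proof.
have [H' psih] := endo_h psi_hom (can_inj psiK).
have [H phih] := endo_h phi_hom (can_inj phiK).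
have sH' := auto_h_size psi_hom phi_hom phiK psih.
have [_ _ psiM _] := psi_hom; have [_ _ _ psipev _] := alg_hom_ops psi_hom.
have [_ _ phiM _] := phi_hom; have [_ _ phiX phipev phiS] := alg_hom_ops phi_hom.
have [hx _ _] := rel.
have := congr1 psi hx; rewrite !psiM -pevE psipev psih -pev_comp.
case/(intertwiner_exponents f2 HA sH') => n [c psix].
have [g gP] := gradedP HA 1 1.
have xE : x = \sum_(j < n) phi x ^+ (j + 1) * phi (pev h (c j)) * phi y ^+ (j + 0).
  rewrite -{1}[x]psiK psix phiS; apply: eq_bigr => j _.
  by rewrite /mon !phiM !phiX addn1 addn0.
have dx : deg g x = 1%N.
  have [_ gmon] := gP; have := gmon 1%N 1 0%N.
  rewrite /mon expr0 expr1 rmorph1 !mulr1 /deg => ->.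
  by rewrite expr1 size_mulX ?polyC_eq0 ?(Hq_x_neq0 HA) // size_polyC (Hq_x_neq0 HA).
have dX := auto_deg_x phi_hom psi_hom phiK psiK gP phih.
have dY := auto_deg_y phi_hom psi_hom phiK psiK gP phih.
have := deg_sandwich (w := fun j => phi (pev h (c j))) (a := 1) (b := 0)
  (n := n) gP dX dY.
rewrite -xE dx expr0 expr1 mulr1 => xE'.
(* The sandwich lemma leaves x = phi(x) phi(c_0(h)), which is phi applied to x c_0(h). *)
exists (c 0%N); apply: (can_inj phiK); rewrite phiM psiK; apply: xE' => // j.
by rewrite phipev phih -pev_comp deg_pev.
Qed.

(** As for [auto_x_pev], now with monomials x^j p(h) y^(j+1). *)
Lemma auto_y_pev : exists p, psi y = pev h p * y.
Proof.
have [H' psih] := endo_h psi_hom (can_inj psiK).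
have [H phih] := endo_h phi_hom (can_inj phiK).
have sH' := auto_h_size psi_hom phi_hom phiK psih.
have [_ _ psiM _] := psi_hom; have [_ _ _ psipev _] := alg_hom_ops psi_hom.
have [_ _ phiM _] := phi_hom; have [_ _ phiX phipev phiS] := alg_hom_ops phi_hom.
have [_ yh _] := rel.
have := congr1 psi yh; rewrite !psiM -pevE psipev psih -pev_comp.
case/(intertwiner_exponents_r f2 HA sH') => n [c psiy].
have [g gP] := gradedP HA 1 1.
have yE : y = \sum_(j < n) phi x ^+ (j + 0) * phi (pev h (c j)) * phi y ^+ (j + 1).
  rewrite -{1}[y]psiK psiy phiS; apply: eq_bigr => j _.
  by rewrite /mon !phiM !phiX addn1 addn0.
have dy : deg g y = 1%N.
  have [_ gmon] := gP; have := gmon 0%N 1 1%N.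
  rewrite /mon expr0 expr1 rmorph1 !mul1r /deg => ->.
  by rewrite expr1 size_mulX ?polyC_eq0 ?(Hq_y_neq0 HA) // size_polyC (Hq_y_neq0 HA).
have dX := auto_deg_x phi_hom psi_hom phiK psiK gP phih.
have dY := auto_deg_y phi_hom psi_hom phiK psiK gP phih.
have := deg_sandwich (w := fun j => phi (pev h (c j))) (a := 0) (b := 1)
  (n := n) gP dX dY.
rewrite -yE dy expr0 expr1 mul1r => yE'.
exists (c 0%N); apply: (can_inj phiK); rewrite phiM psiK; apply: yE' => // j.
by rewrite phipev phih -pev_comp deg_pev.
Qed.
End Inverses2.
End AutomorphismShape.

(** * Affine maps commuting with f *)

Section AffineSymmetries.
Variables (F : fieldType) (f : {poly F}).

Definition affine (a b : F) : {poly F} := a *: 'X + b%:P.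

(** The map aX + b is invertible and commutes with f under composition. *)
Definition affine_sym a b := (a != 0) /\ f \Po affine a b = a *: f + b%:P.

Lemma affine_comp a b a' b' :
  affine a b \Po affine a' b' = affine (a * a') (a * b' + b).
Proof.
rewrite /affine comp_polyD comp_polyZ comp_polyX comp_polyC.
by rewrite scalerDr scalerA polyCD polyCM mul_polyC addrA.
Qed.

Lemma affine_sym1 : affine_sym 1 0.
Proof. by rewrite /affine_sym oner_neq0 /affine !scale1r !addr0 comp_polyXr. Qed.

Lemma affine_symM a b a' b' :
  affine_sym a b -> affine_sym a' b' -> affine_sym (a * a') (a * b' + b).
Proof.
move=> [a0 fa] [a'0 fa']; split; first exact: mulf_neq0.
rewrite -affine_comp comp_polyA fa comp_polyD comp_polyZ comp_polyC fa'.
by rewrite scalerDr scalerA polyCD polyCM mul_polyC addrA.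
Qed.

Lemma coef_affineX a b i :
  [/\ (size (affine a b ^+ i) <= i.+1)%N, (affine a b ^+ i)`_i = a ^+ i
    & (affine a b ^+ i.+1)`_i = i.+1%:R * a ^+ i * b].
Proof.
have coefM p k : (affine a b * p)`_k.+1 = a * p`_k + b * p`_k.+1.
  by rewrite /affine mulrDl coefD -scalerAl coefZ coefXM mul_polyC coefZ.
have coefM0 p : (affine a b * p)`_0 = b * p`_0.
  by rewrite /affine mulrDl coefD -scalerAl coefZ coefXM mulr0 add0r mul_polyC coefZ.
elim: i => [|i [sz IH1 IH2]].
  rewrite !expr0 size_poly1 coef1 !mulr1 mul1r expr1; split=> //.
  by rewrite -[affine a b]mulr1 coefM0 coef1 mulr1.
have sz' : (size (affine a b ^+ i.+1) <= i.+2)%N.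
  apply/leq_sizeP => -[|k] // ik; rewrite exprS coefM.
  have /leq_sizeP szi := sz; rewrite !szi ?mulr0 ?addr0 //.
  exact: ltnW.
have c1 : (affine a b ^+ i.+1)`_i.+1 = a ^+ i.+1.
  by rewrite exprS coefM IH1 (leq_sizeP _ _ sz) // mulr0 addr0 -exprS.
split=> //; rewrite exprS coefM c1 IH2.
by rewrite mulrA mulrCA -exprS [b * _]mulrC -mulrDl -[X in _ + X]mul1r -mulrDl natr1.
Qed.

(** Here deg f = n+2. The top coefficients give a^(n+2) = a; the next ones give an equation linear
    in b. The formula for b says that all these affine maps fix one common point. *)
Lemma affine_symP n a b : size f = n.+3 -> n.+2%:R != 0 :> F -> affine_sym a b ->
  a ^+ n.+1 = 1 /\ b = (a - 1) * (f`_n.+1 / (n.+2%:R * f`_n.+2)).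
Proof.
move=> sf n0 [a0 fab].
have fn0 : f`_n.+2 != 0.
  by rewrite -[n.+2]/n.+3.-1 -sf -lead_coefE lead_coef_eq0 -size_poly_gt0 sf.
have coefS k i : (i < k)%N -> (affine a b ^+ i)`_k = 0.
  by move=> ik; have [/leq_sizeP sz _ _] := coef_affineX a b i; apply: sz.
have /(congr1 (fun p : {poly F} => p`_n.+2)) := fab.
rewrite comp_polyE sf coef_sum big_ord_recr big1 => [|i _]; last first.
  by rewrite coefZ coefS ?mulr0 //; exact: ltn_ord i.
rewrite /= add0r coefZ coefD coefZ coefC addr0 /=.
have [_ -> _] := coef_affineX a b n.+2.
rewrite [RHS]mulrC => /(mulfI fn0); rewrite exprS -[RHS]mulr1 => /(mulfI a0) an1.
split=> //; have /(congr1 (fun p : {poly F} => p`_n.+1)) := fab.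
rewrite comp_polyE sf coef_sum 2!big_ord_recr big1 => [|i _]; last first.
  by rewrite coefZ coefS ?mulr0 //; exact: ltn_ord i.
rewrite /= add0r !coefZ coefD coefZ coefC addr0 /=.
have [_ -> _] := coef_affineX a b n.+1.
have [_ _ ->] := coef_affineX a b n.+1; rewrite an1 !mulr1 => fE.
have {}fE : b * (n.+2%:R * f`_n.+2) = (a - 1) * f`_n.+1.
  by rewrite mulrBl mul1r -fE addrAC subrr add0r [RHS]mulrC mulrA [b * _]mulrC.
by rewrite mulrA -fE mulfK // mulf_neq0.
Qed.
End AffineSymmetries.

(** [P] lies among the m-th roots of unity, so a longest duplicate-free list of its elements exists
    and exhausts it. If k is its length, all entries are k-th roots of unity, and k distinct ones
    include a primitive one. *)
Lemma finite_order_group_cyclic (F : fieldType) (P : F -> Prop) (m : nat) :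
  (0 < m)%N -> P 1 -> (forall a b, P a -> P b -> P (a * b)) ->
  (forall a, P a -> a ^+ m = 1) ->
  exists z, P z /\ forall a, P a -> exists k, a = z ^+ k.
Proof.
move=> m0 P1 PM Pm.
pose Q k := `[< exists s : seq F, [/\ uniq s, forall a, a \in s -> P a & size s = k] >].
have Q_bound k : Q k -> (k <= m)%N.
  move=> /asboolP[s [us sP <-]]; apply: (max_unity_roots m0) us.
  by apply/allP => a /sP/Pm am; apply/unity_rootP.
have Q0 : exists k, Q k by exists 0%N; apply/asboolP; exists [::].
case: (ex_maxnP Q0 Q_bound) => k /asboolP[s [us sP sk]] k_max.
have Ps a : P a -> a \in s.
  move=> Pa; apply/negPn/negP => nas; suff: (k.+1 <= k)%N by rewrite ltnn.
  apply: k_max; apply/asboolP; exists (a :: s); split=> /=; rewrite ?nas ?sk //.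
  by move=> b; rewrite inE => /predU1P[-> //|/sP].
have a_n0 a : P a -> a != 0.
  move=> /Pm am; apply: contra_eq_neq am => ->.
  by rewrite expr0n gtn_eqF // eq_sym oner_neq0.
(* Multiplication by [a] permutes [s]; comparing the products of the two lists gives a^k = 1. *)
have sk1 a : a \in s -> a ^+ k = 1.
  move=> sa; have Pa := sP _ sa.
  have uas : uniq (map (GRing.mul a) s).
    by rewrite map_inj_uniq //; exact: mulfI (a_n0 _ Pa).
  have pas : perm_eq (map (GRing.mul a) s) s.
    apply: uniq_perm => //; apply: (uniq_min_size uas _ _).2.
      by move=> _ /mapP[b /sP Pb ->]; apply/Ps/PM.
    by rewrite size_map.
  have : \prod_(b <- map (GRing.mul a) s) b = \prod_(b <- s) b.
    exact: perm_big.
  rewrite big_map big_split /= big_const_seq count_predT sk iter_mulr_1.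
  rewrite -[RHS]mul1r; apply: mulIf.
  by rewrite prodf_seq_neq0; apply/allP => b /sP/a_n0.
have k0 : (0 < k)%N by rewrite -sk; case: (s) (Ps 1 P1).
have /hasP[z sz z_prim] : has k.-primitive_root s.
  apply: has_prim_root; rewrite ?sk //.
  by apply/allP => a sa; apply/unity_rootP; exact: sk1.
exists z; split; first exact: sP.
by move=> a /Ps/sk1/(prim_rootP z_prim)[i ->]; exists i.
Qed.

(** * The automorphism group *)

Lemma alg_hom_inv (F : fieldType) (A B : algType F) (g : A -> B) (k : B -> A) :
  is_alg_hom g -> cancel g k -> cancel k g -> is_alg_hom k.
Proof.
move=> [gD gZ gM g1] gK kK; have g_inj := can_inj gK.
split=> [a b|c a|a b|]; apply: g_inj; last by rewrite kK g1.
- by rewrite gD !kK.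
- by rewrite gZ !kK.
- by rewrite gM !kK.
Qed.

Lemma alg_hom_iter (F : fieldType) (A : algType F) (g : A -> A) k :
  is_alg_hom g -> is_alg_hom (iter k g).
Proof.
move=> g_hom; elim: k => [|k IHk]; first exact: alg_hom_id.
exact: (alg_hom_comp g_hom IHk).
Qed.

Section AutomorphismGroup.
Variables (F : fieldType) (q : F) (f : {poly F}) (A : algType F) (x y h : A).
Hypotheses (q0 : q != 0) (f2 : (2 < size f)%N) (HA : is_Hq q f x y h).

Let rel : hq_rel q f x y h. Proof. by case: HA. Qed.

Definition scaling_affine (phi : A -> A) lam mu a b :=
  [/\ phi x = lam *: x, phi y = mu *: y & phi h = a *: h + b%:A].

Lemma pev_affine a b : pev h (affine a b) = a *: h + b%:A.
Proof. by rewrite /affine linearP /= pevX pevC. Qed.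

(** If phi(x) = x p(h) and psi(x) = x p'(h), then phi(psi(x)) = x gives p p'(H) = 1, so p is a
    nonzero constant; likewise for y. Cancelling x in the image of hx = xf(h) shows that H commutes
    with f. *)
Lemma is_aut_shape phi : is_aut phi -> exists lam mu a b,
  [/\ scaling_affine phi lam mu a b, lam != 0, mu != 0 & affine_sym f a b].
Proof.
move=> [phi_hom [psi phiK psiK]]; have psi_hom := alg_hom_inv phi_hom phiK psiK.
have [H phih] := endo_h q0 f2 HA phi_hom (can_inj phiK).
have sH := auto_h_size q0 f2 HA phi_hom psi_hom psiK phih.
have [_ _ phiM _] := phi_hom; have [_ _ _ phipev _] := alg_hom_ops phi_hom.
have phipevh p : phi (pev h p) = pev h (p \Po H) by rewrite phipev phih pev_comp.
have const (p r : {poly F}) : p * r = 1 -> exists2 c, p = c%:P & c != 0.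
  move=> /(congr1 (fun s : {poly F} => size s == 1%N)).
  rewrite size_mul_eq1 size_poly1 eqxx => /andP[/size_poly1P[c c0 ->] _].
  by exists c.
have [px phix] := auto_x_pev q0 f2 HA psi_hom phi_hom psiK phiK.
have [px' psix] := auto_x_pev q0 f2 HA phi_hom psi_hom phiK psiK.
have [py phiy] := auto_y_pev q0 f2 HA psi_hom phi_hom psiK phiK.
have [py' psiy] := auto_y_pev q0 f2 HA phi_hom psi_hom phiK psiK.
have [lam pxE lam0] : exists2 c, px = c%:P & c != 0.
  apply: (const _ (px' \Po H)); apply: (x_pev_inj HA).
  by rewrite rmorphM rmorph1 /= mulr1 mulrA -phix -phipevh -phiM -psix psiK.
have [mu pyE mu0] : exists2 c, py = c%:P & c != 0.
  apply: (const _ (py' \Po H)); apply: (pev_y_inj HA).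
  by rewrite mulrC rmorphM rmorph1 /= mul1r -mulrA -phiy -phipevh -phiM -psiy psiK.
have phix' : phi x = lam *: x by rewrite phix pxE pevC -scalerAr mulr1.
have phiy' : phi y = mu *: y by rewrite phiy pyE pevC mulr_algl.
have HE : H = affine H`_1 H`_0.
  apply/polyP => -[|[|i]]; rewrite /affine coefD coefZ coefX coefC;
    rewrite ?mulr0 ?mulr1 ?add0r ?addr0 //.
  by rewrite nth_default ?sH.
exists lam, mu, H`_1, H`_0; split=> //.
  by split=> //; rewrite phih -pev_affine -HE.
split.
  by rewrite -[1%N]/(2.-1) -sH -lead_coefE lead_coef_eq0 -size_poly_gt0 sH.
have [hx _ _] := rel.
have := congr1 phi hx; rewrite !phiM phix' -pevE phipevh phih -scalerAr -scalerAl.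
move=> /(scalerI lam0); rewrite (pev_x rel) => /(x_pev_inj HA) fH.
by rewrite -HE -fH [in LHS]HE /affine comp_polyD comp_polyZ comp_polyX comp_polyC.
Qed.

Lemma scaling_affine_hom lam mu a b : affine_sym f a b ->
  exists2 phi, is_alg_hom phi & scaling_affine phi lam mu a b.
Proof.
move=> [a0 fab]; have [_ univ] := HA; have [hx yh yx] := rel.
have rel' : hq_rel q f (lam *: x) (mu *: y) (a *: h + b%:A).
  have fh : aeval f (a *: h + b%:A) = pev h (a *: f + b%:P).
    by rewrite -pev_affine -pevE -pev_comp fab.
  have fE : pev h (affine a b \Po f) = pev h (a *: f + b%:P).
    by rewrite /affine comp_polyD comp_polyZ comp_polyX comp_polyC.
  split.
  - by rewrite fh -pev_affine -scalerAr -scalerAl (pev_x rel) fE.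
  - by rewrite fh -pev_affine -scalerAr -scalerAl (y_pev rel) fE.
  by rewrite -!scalerAl -!scalerAr yx !scalerA; congr (_ *: _); ring.
have [g [g_hom gx gy gh _]] := univ _ _ _ _ rel'.
by exists g.
Qed.

(** The affine parts compose in the opposite order: phi(a'h + b') = a'(ah + b) + b'. *)
Lemma scaling_affine_comp phi psi lam mu a b lam' mu' a' b' :
  is_alg_hom phi -> scaling_affine phi lam mu a b ->
  scaling_affine psi lam' mu' a' b' ->
  scaling_affine (phi \o psi) (lam * lam') (mu * mu') (a * a') (b * a' + b').
Proof.
move=> [phiD phiZ phiM phi1] [px py ph] [sx sy sh]; split=> /=.
- by rewrite sx phiZ px scalerA mulrC.
- by rewrite sy phiZ py scalerA mulrC.
rewrite sh phiD !phiZ ph phi1 scalerDr !scalerA scalerDl addrA.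
by rewrite [a * a']mulrC [b * a']mulrC.
Qed.

Lemma scaling_affine_ext phi psi lam mu a b :
  is_alg_hom phi -> is_alg_hom psi -> scaling_affine phi lam mu a b ->
  scaling_affine psi lam mu a b -> phi =1 psi.
Proof.
move=> phi_hom psi_hom [px py ph] [sx sy sh].
by apply: (Hq_hom_ext HA) => //; rewrite ?px ?py ?ph.
Qed.

Lemma scaling_affine_id : scaling_affine id 1 1 1 0.
Proof. by split; rewrite ?scale1r // scale0r addr0. Qed.

Lemma affine_symV a b : affine_sym f a b -> affine_sym f a^-1 (- (a^-1 * b)).
Proof.
move=> [a0 fab]; split; first by rewrite invr_eq0.
have L1 : affine a b \Po affine a^-1 (- (a^-1 * b)) = 'X.
  by rewrite affine_comp mulrN mulrA mulfV // mul1r addNr /affine scale1r addr0.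
have : (a *: f + b%:P) \Po affine a^-1 (- (a^-1 * b)) = f.
  by rewrite -fab -comp_polyA L1 comp_polyXr.
rewrite comp_polyD comp_polyZ comp_polyC => /(canRL (addrK _)) /(canRL (scalerK a0)) ->.
by rewrite scalerBr polyCN polyCM mul_polyC.
Qed.

(** The inverse is built from the inverse scalars and the inverse affine map; both composites have
    the parameters of the identity. *)
Lemma scaling_affine_aut lam mu a b : lam != 0 -> mu != 0 -> affine_sym f a b ->
  exists2 phi, is_aut phi & scaling_affine phi lam mu a b.
Proof.
move=> lam0 mu0 ab; have ab' := affine_symV ab; have [a0 _] := ab.
have [phi phi_hom phiE] := scaling_affine_hom lam mu ab.
have [psi psi_hom psiE] := scaling_affine_hom lam^-1 mu^-1 ab'.
exists phi => //; split=> //; exists psi.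
  apply: (scaling_affine_ext (alg_hom_comp psi_hom phi_hom) (@alg_hom_id _ A)
    _ scaling_affine_id).
  have := scaling_affine_comp psi_hom psiE phiE.
  by rewrite !mulVf // mulNr mulrAC mulVf // mul1r addNr.
apply: (scaling_affine_ext (alg_hom_comp phi_hom psi_hom) (@alg_hom_id _ A)
  _ scaling_affine_id).
have := scaling_affine_comp phi_hom phiE psiE.
by rewrite !mulfV // [b * _]mulrC subrr.
Qed.
End AutomorphismGroup.

Theorem theorem5p4 (F : fieldType) (q : F) (f : {poly F}) (A : algType F)
    (x y h : A) :
  q != 0 -> (2 < size f)%N -> is_Hq q f x y h ->
  (* Aut(A) = H K, with H = {phi : phi x = x, phi y = y}, K = {phi : phi h = h} *)
  (forall phi : A -> A, is_aut phi ->
     exists alpha beta : A -> A,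
       [/\ is_aut alpha /\ alpha x = x /\ alpha y = y,
           is_aut beta /\ beta h = h & phi =1 alpha \o beta]) /\
  (* H and K intersect trivially *)
  (forall phi : A -> A, is_aut phi -> phi x = x -> phi y = y -> phi h = h ->
     phi =1 id) /\
  (* H is normal in Aut(A) *)
  (forall phi alpha phiinv : A -> A, is_aut phi -> cancel phi phiinv ->
     cancel phiinv phi -> is_aut alpha -> alpha x = x -> alpha y = y ->
     (phi \o alpha \o phiinv) x = x /\ (phi \o alpha \o phiinv) y = y) /\
  (* K = { psi_{lam,mu} : lam, mu in F^* } *)
  (forall lam mu : F, lam != 0 -> mu != 0 ->
     exists psi : A -> A,
       [/\ is_aut psi, psi x = lam *: x, psi y = mu *: y & psi h = h]) /\
  (forall phi : A -> A, is_aut phi -> phi h = h ->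
     exists lam mu : F,
       [/\ lam != 0, mu != 0, phi x = lam *: x & phi y = mu *: y]) /\
  (* (lam, mu) |-> psi_{lam,mu} is injective, so K is isomorphic to F^* x F^* *)
  (forall (psi : A -> A) (lam mu lam' mu' : F),
     psi x = lam *: x -> psi y = mu *: y ->
     psi x = lam' *: x -> psi y = mu' *: y -> lam = lam' /\ mu = mu') /\
  (* K is central in Aut(A) *)
  (forall phi psi : A -> A, is_aut phi -> is_aut psi -> psi h = h ->
     phi \o psi =1 psi \o phi) /\
  (([pchar F] =i pred0 \/ exists2 p : nat, p \in [pchar F] & ((size f).-1 < p)%N) ->
    (* H is finite cyclic of order dividing deg f - 1 *)
    (exists g : A -> A,
       [/\ is_aut g, g x = x, g y = y,
           forall alpha : A -> A, is_aut alpha -> alpha x = x -> alpha y = y ->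
             exists k : nat, alpha =1 iter k g
         & iter (size f).-2 g =1 id]) /\
    (* Aut(A) is abelian *)
    (forall phi phi' : A -> A, is_aut phi -> is_aut phi' ->
       phi \o phi' =1 phi' \o phi)).
Proof.
move=> q0 f2 HA.
have x0 := Hq_x_neq0 HA; have y0 := Hq_y_neq0 HA.
have sym1 := affine_sym1 f.
have scaleI (u : A) (c d : F) : u != 0 -> c *: u = d *: u -> c = d.
  move=> u0 /eqP; rewrite -subr_eq0 -scalerBl scaler_eq0 (negPf u0) orbF subr_eq0.
  by move/eqP.
have fix_xy phi lam mu a b : scaling_affine x y h phi lam mu a b ->
    phi x = x -> phi y = y -> lam = 1 /\ mu = 1.
  move=> [px py _]; rewrite px py => /esym lx /esym my.
  by split; [apply: (scaleI x) | apply: (scaleI y)]; rewrite // scale1r.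
have fix_h phi lam mu a b : scaling_affine x y h phi lam mu a b ->
    phi h = h -> a = 1 /\ b = 0.
  move=> [_ _ ph]; rewrite ph -pev_affine -{2}[h]pevX => /(pev_inj HA) E.
  split.
    have := congr1 (fun p : {poly F} => p`_1) E.
    by rewrite /affine coefD coefZ !coefX coefC mulr1 addr0.
  have := congr1 (fun p : {poly F} => p`_0) E.
    by rewrite /affine coefD coefZ !coefX coefC mulr0 add0r.
split; [|split; [|split; [|split; [|split; [|split; [|split]]]]]].
- move=> phi phi_aut.
  have [lam [mu [a [b [phiE lam0 mu0 ab]]]]] := is_aut_shape q0 f2 HA phi_aut.
  (* [alpha] takes the affine part of [phi], and [beta] its scalings. *)
  have [alpha alpha_aut alphaE] := scaling_affine_aut HA (oner_neq0 _) (oner_neq0 _) ab.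
  have [beta beta_aut betaE] := scaling_affine_aut HA lam0 mu0 sym1.
  exists alpha, beta; split; first by case: alphaE => -> -> _; rewrite !scale1r.
    by case: betaE => _ _ ->; rewrite scale1r scale0r addr0.
  have [[phi_hom _] [alpha_hom _] [beta_hom _]] := And3 phi_aut alpha_aut beta_aut.
  apply: (scaling_affine_ext HA phi_hom (alg_hom_comp alpha_hom beta_hom) phiE).
  by have := scaling_affine_comp alpha_hom alphaE betaE; rewrite !mul1r !mulr1 addr0.
- move=> phi [phi_hom _] px py ph.
  exact: (Hq_hom_ext HA phi_hom (@alg_hom_id _ A)).
- move=> phi alpha phiinv [phi_hom phi_bij] phiK phiinvK [alpha_hom _] ax ay.
  have [lam [mu [a [b [[px py _] lam0 mu0 _]]]]] :=
    is_aut_shape q0 f2 HA (conj phi_hom phi_bij).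
  have [_ phiZ _ _] := phi_hom; have [_ alphaZ _ _] := alpha_hom.
  (* The inverse of [phi] only rescales x and y, and [alpha] fixes the rescaled elements. *)
  have invx : phiinv x = lam^-1 *: x.
    by apply: (can_inj phiK); rewrite phiinvK phiZ px scalerA mulVf // scale1r.
  have invy : phiinv y = mu^-1 *: y.
    by apply: (can_inj phiK); rewrite phiinvK phiZ py scalerA mulVf // scale1r.
  by rewrite /= invx invy !alphaZ ax ay -invx -invy !phiinvK.
- move=> lam mu lam0 mu0.
  have [phi phi_aut [px py ph]] := scaling_affine_aut HA lam0 mu0 sym1.
  by exists phi; split=> //; rewrite ph scale1r scale0r addr0.
- move=> phi phi_aut ph.
  have [lam [mu [a [b [[px py _] lam0 mu0 _]]]]] := is_aut_shape q0 f2 HA phi_aut.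
  by exists lam, mu.
- move=> psi lam mu lam' mu' px py; rewrite px py => lx my.
  by split; [apply: (scaleI x) | apply: (scaleI y)].
- move=> phi psi phi_aut psi_aut psih.
  have [lam [mu [a [b [phiE _ _ _]]]]] := is_aut_shape q0 f2 HA phi_aut.
  have [lam' [mu' [a' [b' [psiE _ _ _]]]]] := is_aut_shape q0 f2 HA psi_aut.
  have [a1 b1] := fix_h _ _ _ _ _ psiE psih; rewrite {}a1 {}b1 in psiE.
  have [[phi_hom _] [psi_hom _]] := conj phi_aut psi_aut.
  apply: (scaling_affine_ext HA (alg_hom_comp phi_hom psi_hom)
    (alg_hom_comp psi_hom phi_hom) (scaling_affine_comp phi_hom phiE psiE)).
  have := scaling_affine_comp psi_hom psiE phiE.
  by rewrite !mulr1 !mul1r mul0r add0r addr0 [lam * _]mulrC [mu * _]mulrC.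
(* From here deg f is n+2, and the bound deg f - 1 on the order is n+1. *)
have := f2; case sf : (size f) => [|[|[|n]]] //= _ chF.
(* Under either assumption on the characteristic, deg f is invertible in F. *)
have n0 : n.+2%:R != 0 :> F.
  case: chF => [/pcharf0P-> // | [p pF np]].
  by rewrite -(dvdn_pcharf pF) gtnNdvd.
set k := f`_n.+1 / (n.+2%:R * f`_n.+2).
have symP a b : affine_sym f a b -> a ^+ n.+1 = 1 /\ b = (a - 1) * k.
  exact: affine_symP sf n0.
split; last first.
  move=> phi psi phi_aut psi_aut.
  have [lam [mu [a [b [phiE _ _ /symP[_ bE]]]]]] := is_aut_shape q0 f2 HA phi_aut.
  have [lam' [mu' [a' [b' [psiE _ _ /symP[_ bE']]]]]] := is_aut_shape q0 f2 HA psi_aut.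
  have [[phi_hom _] [psi_hom _]] := conj phi_aut psi_aut.
  apply: (scaling_affine_ext HA (alg_hom_comp phi_hom psi_hom)
    (alg_hom_comp psi_hom phi_hom) (scaling_affine_comp phi_hom phiE psiE)).
  have := scaling_affine_comp psi_hom psiE phiE.
  rewrite [lam * _]mulrC [mu * _]mulrC [a * _]mulrC.
  (* Both sides equal (aa' - 1)k, since the two affine maps share the fixed point -k. *)
  suff -> : b * a' + b' = b' * a + b by [].
  by rewrite bE bE'; ring.
have P_M a b : affine_sym f a ((a - 1) * k) -> affine_sym f b ((b - 1) * k) ->
    affine_sym f (a * b) ((a * b - 1) * k).
  move=> fa fb; have := affine_symM fa fb.
  suff -> : a * ((b - 1) * k) + (a - 1) * k = (a * b - 1) * k by [].
  by ring.
have P_1 : affine_sym f 1 ((1 - 1) * k) by rewrite subrr mul0r.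
(* Since b = (a - 1)k, an affine symmetry is determined by its slope; the slopes form a
   multiplicative set of (n+1)-th roots of unity. *)
have [z [Pz zP]] := @finite_order_group_cyclic F (fun a => affine_sym f a ((a - 1) * k))
  n.+1 (ltn0Sn n) P_1 P_M (fun a fa => (symP _ _ fa).1).
have [g g_aut gE] := scaling_affine_aut HA (oner_neq0 _) (oner_neq0 _) Pz.
have [g_hom _] := g_aut.
have iterE i : scaling_affine x y h (iter i g) 1 1 (z ^+ i) ((z ^+ i - 1) * k).
  elim: i => [|i IHi]; first by rewrite expr0 subrr mul0r; exact: scaling_affine_id.
  have := scaling_affine_comp g_hom gE IHi; rewrite !mul1r -exprS.
  suff -> : (z - 1) * k * z ^+ i + (z ^+ i - 1) * k = (z ^+ i.+1 - 1) * k by [].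
  by rewrite exprS; ring.
exists g; split=> //.
- by case: gE => -> _ _; rewrite scale1r.
- by case: gE => _ -> _; rewrite scale1r.
- move=> alpha alpha_aut ax ay.
  have [lam [mu [a [b [alphaE _ _ ab]]]]] := is_aut_shape q0 f2 HA alpha_aut.
  have [lam1 mu1] := fix_xy _ _ _ _ _ alphaE ax ay.
  have [_ bE] := symP _ _ ab; rewrite {}bE in ab alphaE.
  have [i aE] := zP _ ab; exists i; have [alpha_hom _] := alpha_aut.
  apply: (scaling_affine_ext HA alpha_hom (alg_hom_iter i g_hom) _ (iterE i)).
  by rewrite -aE -{1}lam1 -{1}mu1.
(* As z^(n+1) = 1, the iterate has the parameters of the identity, so the order of [g] divides deg f
   - 1. *)
apply: (scaling_affine_ext HA (alg_hom_iter n.+1 g_hom) (@alg_hom_id _ A) (iterE n.+1)).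
have [zn _] := symP _ _ Pz.
by rewrite zn subrr mul0r; exact: scaling_affine_id.
Qed.
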